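(* One has $$\bar c_2 \ \ge\ 0.0515599\ldots .$$ That means: for every integer $N\ge 1$ and every $N$-point set $\mathcal{P}\subset[0,1)^2$, $$\left\|D_{\mathcal{P}}\,|\,L_2\right\| \ \ge\ 0.0515599\ldots\cdot\sqrt{\log N}.$$ Moreover, $$\bar b_2 \ \ge\ 0.0610739\ldots .$$
   Context: For a finite set $\mathcal{P}=\{p_1,\dots,p_N\}$ of $N$ points in $[0,1)^2$ and $x=(x_1,x_2)\in[0,1)^2$ let $B_x=[0,x_1)\times[0,x_2)$ and define the discrepancy function $$D_{\mathcal{P}}(x)=\sum_{i=1}^N\chi_{B_x}(p_i)-N x_1x_2,$$ where $\chi_{B_x}$ is the characteristic function of $B_x$. The $L_2$-discrepancy of $\mathcal{P}$ is $$\left\|D_{\mathcal{P}}\,|\,L_2\right\|=\left(\int_{[0,1)^2}D_{\mathcal{P}}(x)^2\,dx\right)^{1/2}.$$ Here $\log$ is the natural logarithm. The constants are $$\bar c_2=\inf_{N\ge2}\ \inf_{\#\mathcal{P}=N}\left\|D_{\mathcal{P}}\,|\,L_2\right\|\cdot(\log N)^{-1/2},\qquad \bar b_2=\limsup_{N\to\infty}\ \inf_{\#\mathcal{P}=N}\left\|D_{\mathcal{P}}\,|\,L_2\right\|\cdot(\log N)^{-1/2},$$ where the inner infimum is over all $N$-point sets $\mathcal{P}$ in $[0,1)^2$. Convention on decimals: $0.0515599\ldots$ and $0.0610739\ldots$ each denote some real constant (independent of $N$ and $\mathcal{P}$) whose decimal expansion begins with the displayed digits; thus the assertions are that the inequalities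 hold for some such constants, equivalently that they hold with the truncated values $0.0515599$ and $0.0610739$. *)

(* Defs.v *)
From HB Require Import structures.
From mathcomp Require Import all_boot all_order all_algebra finmap.
From mathcomp Require Import all_classical all_reals all_analysis.

Set Implicit Arguments.
Unset Strict Implicit.
Unset Printing Implicit Defensive.

Import Order.TTheory GRing.Theory Num.Theory.
Import numFieldNormedType.Exports.

Local Open Scope classical_set_scope.
Local Open Scope ring_scope.

Section discrepancy.
Variable R : realType.

Definition unit_square : set (R * R) := `[0, 1[ `*` `[0, 1[.

Definition box (x : R * R) : set (R * R) := `[0, x.1[ `*` `[0, x.2[.

Definition discrepancy (P : {fset R * R}) (x : R * R) : R :=
  (\sum_(p <- P) \1_(box x) p) - #|` P|%:R * x.1 * x.2.

Definition L2_discrepancy (P : {fset R * R}) : R :=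
  Num.sqrt (\int[(@lebesgue_measure R \x @lebesgue_measure R)%E]_(x in unit_square)
              discrepancy P x ^+ 2).

(* The type annotation on the bound P matters: without it, elaboration adds a
   universe constraint incompatible with algebra-tactics' ring and lra. *)
Definition point_sets (N : nat) : set {fset R * R} :=
  [set P : {fset R * R} | [set` P] `<=` unit_square /\ #|` P| = N].

(* Infima and the limit superior are taken in the extended reals, so that they
   need no side condition; only the values at N >= 2 are meaningful (the
   division by sqrt (ln N) is degenerate for N = 0, 1). *)
Definition normalized_min_discrepancy (N : nat) : \bar R :=
  ereal_inf [set (L2_discrepancy P / Num.sqrt (ln N%:R))%:E
            | P in point_sets N].

Definition c2bar : \bar R :=
  ereal_inf [set normalized_min_discrepancy N | N in [set N : nat | (2 <= N)%N]].

Definition b2bar : \bar R := limn_esup normalized_min_discrepancy.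

End discrepancy.

(* Main.v *)
Require Import Defs.
From mathcomp Require Import all_boot all_order all_algebra finmap.
From mathcomp Require Import all_classical all_reals all_analysis.
From mathcomp Require Import measurable_realfun ring lra zify.
Import Order.TTheory GRing.Theory Num.Theory.
Import numFieldNormedType.Exports.
Local Open Scope classical_set_scope.
Local Open Scope ring_scope.
Set Implicit Arguments.
Unset Strict Implicit.
Unset Printing Implicit Defensive.

(** The proof refines Roth's method.  By Bessel's inequality ([bessel],
    [sum_haar_energy_le]) the squared norm of the discrepancy function D is at
    least the sum of its squared normalised Haar coefficients.  On a dyadic box I
    of shape 2^-j1 x 2^-j2, with s = N 2^-(j1+j2), the coefficient is, up to a
    factor depending on the shape only, S_I - s/4, where S_I is the sum over the
    points of I of the product of two tents with support I.

    If T denotes the tent map, the height of this product at a point p is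
    t = T^(j1+1)(p1) T^(j2+1)(p2) ([hat_local]), whatever the box that contains p.
    Since S_I^2 is at least the sum of the squares of the heights, the boxes of
    one shape together contribute at least the mean over the points of
    s^2/16 + s t^2 - s^2 t/2, divided by 16 ([haar_energy_ge]).  One such term can
    be as small as s^2 (1 - s)/16, its value at t = s/4.  This is what the
    classical argument keeps: it counts the empty boxes.

    The gain comes from comparing neighbouring shapes.  Halving one side of the
    box halves s, hence also the optimal height s/4, but replaces a factor u of
    the height by T(u), which is 2u when u <= 1/2.  A point cannot be at the
    optimal height for a shape and all its refinements.  For a shape, its two
    refinements and its three second refinements, with weights 1, 1/2, 1/3, the
    total is at least 0.0298 for all factors u, v in [0, 1] as soon as
    0.745 <= s <= 1.49 ([stencil_energy_ge]), and at least 0.0418 for s = 1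
    ([stencil_energy1_ge]).  This is an inequality between piecewise polynomials
    in u and v.  When u <= 1/4, the chain t, 2t, 4t is enough; when both factors
    are between 1/4 and 1/2, the heights t, 2t, 2t, 4t are; otherwise v >= 1/2,
    the total is bounded below by a quadratic polynomial in v, and its
    discriminant by a quartic in u.

    There are k + 1 shapes of level k = j1 + j2, and their stencils can be summed
    without counting any shape more than once ([sum_stencils_le]).  For every N
    there is a k with N 2^-k in the window above, and log N <= (k + 1) log 2
    ([dyadic_scale]); this gives the squared norm at least (k + 1) 0.0298/16 and
    the first constant, since 0.0515599^2 * 0.7 <= 0.0298/16.  The powers of 2, for
    which s = 1 is possible, give the bound on the limit superior. *)

(** * The energy of a stencil of shapes *)

Section TentStencil.
Variable R : realFieldType.
Implicit Types g s t u v : R.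

Definition tent u : R := if u <= 1/2 then 2 * u else 2 - 2 * u.

Lemma tent_left u : u <= 1/2 -> tent u = 2 * u.
Proof. by rewrite /tent => ->. Qed.

Lemma tent_right u : 1/2 <= u -> tent u = 2 - 2 * u.
Proof. by rewrite /tent; case: ifP => // *; lra. Qed.

Lemma tent_sym u : tent (1 - u) = tent u.
Proof.
have [h|h] := leP u (1/2).
  by rewrite tent_right ?tent_left; lra.
by rewrite tent_left ?tent_right; lra.
Qed.

Lemma tent_itv u : 0 <= u <= 1 -> 0 <= tent u <= 1.
Proof. by rewrite /tent; case: ifP => *; lra. Qed.

(** The share of one point, up to the factor 16 N, in a lower bound for the sum of
    the squared Haar coefficients of shape 2^-j1 x 2^-j2: here s = N 2^-(j1+j2) is the mean
    number of points per box and t in [0, 1] the height of the product of tents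
    at the point.  The first term comes from the volume part N x1 x2. *)
Definition cell_energy s t : R := s^+2/16 + s * t^+2 - s^+2/2 * t.

(** The minimum is reached at t = s/4, where the point cancels the volume part
    of the coefficient. *)
Lemma cell_energy_ge s t : 0 <= s -> s^+2 * (1 - s) / 16 <= cell_energy s t.
Proof.
rewrite /cell_energy => s0.
by have := mulr_ge0 s0 (sqr_ge0 (t - s/4)); lra.
Qed.

(** A shape, its two refinements and its three second refinements.  Halving a
    side of the box halves s and applies the tent map to one factor of t.  The
    optimal height s/4 halves with s, whereas the tent map doubles small
    factors: the six cells cannot all be close to their minimum.  The weights
    1, 1/2, 1/3 share each level equally between its shapes, see
    [sum_stencils_le]. *)
Definition stencil_energy s u v : R :=
  let u1 := tent u in let v1 := tent v in
  cell_energy s (u * v)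
  + (cell_energy (s/2) (u1 * v) + cell_energy (s/2) (u * v1)) / 2
  + (cell_energy (s/4) (tent u1 * v) + cell_energy (s/4) (u1 * v1)
     + cell_energy (s/4) (u * tent v1)) / 3.

Lemma stencil_energyC s u v : stencil_energy s u v = stencil_energy s v u.
Proof.
by rewrite /stencil_energy !(mulrC u) !(mulrC (tent u)) !(mulrC (tent (tent u))); lra.
Qed.

Lemma quadratic_ge0 (a b c x : R) :
  0 < a -> b^+2 <= 4 * a * c -> 0 <= a * x^+2 - b * x + c.
Proof.
move=> a0 h; rewrite -(pmulr_rge0 _ a0).
by have := sqr_ge0 (2 * a * x - b); lra.
Qed.

(** Three cells are enough here: refining along u gives the heights t, 2t, 4t
    with t = u v, while the optimal ones are s/4, s/8, s/16.  The bound holds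
    for every v. *)
Lemma stencil_energy_small s u v : 0 <= s -> u <= 1/4 ->
  21/256 * s^+2 - (73/1024 - 333/10000) * s^+3 <= stencil_energy s u v.
Proof.
move=> s0 u4; rewrite /stencil_energy (@tent_left u); last by lra.
rewrite (@tent_left (2 * u)); last by lra.
have s2 : 0 <= s/2 by lra.
have s4 : 0 <= s/4 by lra.
move: (tent v) => v1; move: (tent v1) => v2.
have h1 := @cell_energy_ge _ (u * v1) s2.
have h2 := @cell_energy_ge _ (2 * u * v1) s4.
have h3 := @cell_energy_ge _ (u * v2) s4.
have : 0 <= 10/3 * (u * v)^+2 - (2/3 * s) * (u * v)
            + s^+2 * (205/3072 - 333/10000).
  (* 205/3072 - 333/10000 exceeds (2/3)^2 / (4 * 10/3) = 1/30. *)
  by apply: quadratic_ge0; [lra|have := sqr_ge0 s; lra].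
move=> /(mulr_ge0 s0); move: h1 h2 h3; rewrite /cell_energy; lra.
Qed.

(** Both first refinements have height 2t and the mixed second refinement has
    height 4t; these four cells give the same bound. *)
Lemma stencil_energy_middle s u v : 0 <= s ->
  1/4 <= u <= 1/2 -> 1/4 <= v <= 1/2 ->
  21/256 * s^+2 - (73/1024 - 333/10000) * s^+3 <= stencil_energy s u v.
Proof.
move=> s0 u4 v4; rewrite /stencil_energy !(@tent_left u) ?(@tent_left v); try lra.
have s4 : 0 <= s/4 by lra.
have h1 := @cell_energy_ge _ (tent (2 * u) * v) s4.
have h2 := @cell_energy_ge _ (u * tent (2 * v)) s4.
have : 0 <= 13/3 * (u * v)^+2 - (19/24 * s) * (u * v)
            + s^+2 * (217/3072 - 333/10000).
  by apply: quadratic_ge0; [lra|have := sqr_ge0 s; lra].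
move=> /(mulr_ge0 s0); move: h1 h2; rewrite /cell_energy.
by move: (tent _ * v) (u * tent _) => ? ?; lra.
Qed.

(** For v >= 1/2 and a fixed u, a lower bound of the stencil energy is a
    quadratic polynomial in v, with the following coefficients; u1 and u2 stand
    for the first two tent iterates of u. *)
Definition coef2 s u u1 u2 := s * (2 * u^+2 + 7/12 * u1^+2 + u2^+2/12).
Definition coef1 s u u1 u2 :=
  s^+2 * (3/8 * u + u1/24 + u2/96) + s * (2 * u^+2 + 2/3 * u1^+2).
Definition coef0 s u u1 :=
  21/256 * s^+2 - s^+3/3072 + s * (u^+2 + u1^+2/3) - s^+2 * (u/8 + u1/48).

(** The cell u * tent (tent v) is replaced by its minimum, the only one that
    would force a case distinction on v. *)
Lemma stencil_energy_quadratic s u v : 0 <= s -> 1/2 <= v ->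
  let u1 := tent u in let u2 := tent u1 in
  coef2 s u u1 u2 * v^+2 - coef1 s u u1 u2 * v + coef0 s u u1
  <= stencil_energy s u v.
Proof.
move=> s0 v4; rewrite /stencil_energy /= (@tent_right v)//.
have s4 : 0 <= s/4 by lra.
have := @cell_energy_ge _ (u * tent (2 - 2 * v)) s4.
rewrite /coef2 /coef1 /coef0 /cell_energy.
by move: (tent u) (tent (tent u)) (u * tent _) => ? ? ?; lra.
Qed.

(** A quartic with nonnegative Bernstein coefficients on [l, r] is a nonnegative
    combination of these products. *)
Lemma bernstein4_ge0 (l r u : R) : l <= u <= r ->
  [/\ 0 <= (u - l)^+4, 0 <= (u - l)^+3 * (r - u),
      0 <= (u - l)^+2 * (r - u)^+2, 0 <= (u - l) * (r - u)^+3
    & 0 <= (r - u)^+4].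
Proof.
case/andP; rewrite -subr_ge0 -(subr_ge0 u) => x y.
by split; rewrite ?mulr_ge0 ?exprn_ge0.
Qed.

(** The quadratic polynomial in v is at least g for all real v.  The tent iterates
    are affine on each of the intervals [1/4, 1/2], [1/2, 3/4] and [3/4, 1], where
    the condition is the nonnegativity of a quartic in u. *)
Definition discriminant_le s g := forall u, 1/4 <= u <= 1 ->
  let u1 := tent u in let u2 := tent u1 in
  (coef1 s u u1 u2)^+2 <= 4 * coef2 s u u1 u2 * (coef0 s u u1 - g).

Ltac bernstein h :=
  rewrite /coef2 /coef1 /coef0; case: (bernstein4_ge0 h) => *; lra.

Ltac discriminant_pieces :=
  move=> u u4 /=;
  have [uh|uh] := leP u (1/2);
  [ have h : 1/4 <= u <= 1/2 by lra
  | have [uq|uq] := leP u (3/4);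
    [ have h : 1/2 <= u <= 3/4 by lra | have h : 3/4 <= u <= 1 by lra ] ].

Lemma tent_quarter2 u : 1/4 <= u <= 1/2 ->
  tent u = 2 * u /\ tent (tent u) = 2 - 4 * u.
Proof. by move=> h; rewrite tent_left ?tent_right; lra. Qed.

Lemma tent_quarter3 u : 1/2 <= u <= 3/4 ->
  tent u = 2 - 2 * u /\ tent (tent u) = 4 * u - 2.
Proof. by move=> h; rewrite tent_right ?tent_right; lra. Qed.

Lemma tent_quarter4 u : 3/4 <= u <= 1 ->
  tent u = 2 - 2 * u /\ tent (tent u) = 4 - 4 * u.
Proof. by move=> h; rewrite tent_right ?tent_left; lra. Qed.

Lemma discriminant_le_one : discriminant_le 1 (418/10000).
Proof.
discriminant_pieces.
- by have [-> ->] := tent_quarter2 h; bernstein h.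
- by have [-> ->] := tent_quarter3 h; bernstein h.
- by have [-> ->] := tent_quarter4 h; bernstein h.
Qed.

Lemma discriminant_le_low : discriminant_le (149/200) (298/10000).
Proof.
discriminant_pieces.
- by have [-> ->] := tent_quarter2 h; bernstein h.
- by have [-> ->] := tent_quarter3 h; bernstein h.
- by have [-> ->] := tent_quarter4 h; bernstein h.
Qed.

Lemma discriminant_le_high : discriminant_le (149/100) (298/10000).
Proof.
discriminant_pieces.
(* On the first two pieces the Bernstein coefficients do not all have the right
   sign; cutting at 9/25 and at 5/8, near the minimum, restores it. *)
- have [-> ->] := tent_quarter2 h; have [k|k] := leP u (9/25).
    by have {}h : 1/4 <= u <= 9/25 by [lra]; bernstein h.
  by have {}h : 9/25 <= u <= 1/2 by [lra]; bernstein h.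
- have [-> ->] := tent_quarter3 h; have [k|k] := leP u (5/8).
    by have {}h : 1/2 <= u <= 5/8 by [lra]; bernstein h.
  by have {}h : 5/8 <= u <= 3/4 by [lra]; bernstein h.
- by have [-> ->] := tent_quarter4 h; bernstein h.
Qed.

(** By symmetry u <= v, and one of the three previous regimes applies. *)
Lemma stencil_energy_ge_of_discriminant s g : 0 < s ->
  g <= 21/256 * s^+2 - (73/1024 - 333/10000) * s^+3 -> discriminant_le s g ->
  forall u v, 0 <= u <= 1 -> 0 <= v <= 1 -> g <= stencil_energy s u v.
Proof.
move=> s0 gs disc u v; wlog : u v / u <= v.
  move=> H hu hv; have [uv|/ltW vu] := leP u v; first exact: H.
  by rewrite stencil_energyC; apply: H.
move=> uv hu hv; have [u4|u4] := leP u (1/4).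
  by apply: le_trans gs _; apply: stencil_energy_small; rewrite // ltW.
have [v2|v2] := leP v (1/2).
  by apply: le_trans gs _; apply: stencil_energy_middle; lra.
apply: le_trans (stencil_energy_quadratic u (ltW s0) (ltW v2)).
rewrite -subr_ge0 -addrA.
apply: quadratic_ge0; last by apply: disc; case/andP: hu => _ ->; rewrite ltW.
have u0 : 0 < u by rewrite (lt_trans _ u4)// divr_gt0.
rewrite /coef2 mulr_gt0// -addrA ltr_wpDr ?mulr_gt0//.
by rewrite addr_ge0// mulr_ge0 ?divr_ge0 ?sqr_ge0 ?invr_ge0.
Qed.

(** If b >= 0 the polynomial is increasing in s, otherwise it is concave: the two
    end points decide. *)
Lemma pinned_quadratic_ge (a b g l h s : R) : 0 <= l -> l <= s <= h -> 0 <= a ->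
  g <= l * a + l^+2 * b -> g <= h * a + h^+2 * b -> g <= s * a + s^+2 * b.
Proof.
move=> l0 /andP[ls sh] a0 gl gh; have [b0|b0] := leP 0 b.
  apply: le_trans gl _; rewrite lerD// ler_wpM2r//.
  by rewrite lerXn2r ?nnegrE// (le_trans l0).
have [lh|hl] := ltP l h; last by have -> : s = l by lra.
rewrite -(ler_pM2l (_ : 0 < h - l)) ?subr_gt0//.
have h1 : 0 <= (h - l) * ((s - l) * (h - s) * - b).
  by rewrite !mulr_ge0 ?subr_ge0 ?oppr_ge0// ltW.
have h2 : 0 <= (h - s) * (l * a + l^+2 * b - g) by rewrite mulr_ge0 ?subr_ge0.
have h3 : 0 <= (s - l) * (h * a + h^+2 * b - g) by rewrite mulr_ge0 ?subr_ge0.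
by clear -h1 h2 h3; lra.
Qed.

(** The end points of the window are in ratio 2, so that every number of points
    N has a dyadic level k with N 2^-k in the window. *)
Lemma stencil_energy_ge s u v : 149/200 <= s <= 149/100 ->
  0 <= u <= 1 -> 0 <= v <= 1 -> 298/10000 <= stencil_energy s u v.
Proof.
move=> sb hu hv.
have low : 298/10000 <= stencil_energy (149/200) u v.
  by apply: stencil_energy_ge_of_discriminant discriminant_le_low _ _ hu hv; lra.
have high : 298/10000 <= stencil_energy (149/100) u v.
  by apply: stencil_energy_ge_of_discriminant discriminant_le_high _ _ hu hv; lra.
have [a a0 [b E]] : exists2 a, 0 <= a &
    exists b, forall x, stencil_energy x u v = x * a + x^+2 * b.
  exists ((u * v)^+2 + ((tent u * v)^+2 + (u * tent v)^+2)/4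
    + ((tent (tent u) * v)^+2 + (tent u * tent v)^+2 + (u * tent (tent v))^+2)/12).
    rewrite addr_ge0//; last by rewrite divr_ge0// !addr_ge0// sqr_ge0.
    by rewrite addr_ge0 ?sqr_ge0// divr_ge0// addr_ge0// sqr_ge0.
  exists (21/256 - u * v/2 - (tent u * v + u * tent v)/16
    - (tent (tent u) * v + tent u * tent v + u * tent (tent v))/96) => x.
  by rewrite /stencil_energy /cell_energy; field.
move: low high; rewrite !E.
by apply: pinned_quadratic_ge; rewrite // divr_ge0.
Qed.

(** At s = 1 the bound is much better; this value of s is available when N is a
    power of 2. *)
Lemma stencil_energy1_ge u v :
  0 <= u <= 1 -> 0 <= v <= 1 -> 418/10000 <= stencil_energy 1 u v.
Proof.
by move=> hu hv; apply: stencil_energy_ge_of_discriminant discriminant_le_one _ _ hu hv; lra.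
Qed.

End TentStencil.

(** * Bessel's inequality for bounded functions *)

Section BoundedMeasurable.
Context d (T : measurableType d) (R : realType).
Variables (mu : {measure set T -> \bar R}) (D : set T).
Hypotheses (mD : measurable D) (muD : (mu D < +oo)%E).
Implicit Types f g : T -> R.

(** On a set of finite measure this class is a ring of integrable functions, so
    that integrals of sums and products split without further conditions. *)
Definition bounded_measurable f :=
  measurable_fun D f /\ exists M, forall x, D x -> `|f x| <= M.

Lemma bounded_measurable_cst c : bounded_measurable (fun=> c).
Proof. by split => //; exists `|c|. Qed.

Lemma bounded_measurableD f g : bounded_measurable f -> bounded_measurable g ->
  bounded_measurable (fun x => f x + g x).
Proof.
move=> [mf [A fA]] [mg [B gB]]; split; first exact: measurable_funD.
exists (A + B) => x Dx; apply: le_trans (ler_normD _ _) _.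
by rewrite lerD ?fA ?gB.
Qed.

Lemma bounded_measurableM f g : bounded_measurable f -> bounded_measurable g ->
  bounded_measurable (fun x => f x * g x).
Proof.
move=> [mf [A fA]] [mg [B gB]]; split; first exact: measurable_funM.
by exists (A * B) => x Dx; rewrite normrM ler_pM ?fA ?gB.
Qed.

Lemma bounded_measurableB f g : bounded_measurable f -> bounded_measurable g ->
  bounded_measurable (fun x => f x - g x).
Proof.
move=> mf mg; under eq_fun do rewrite -mulN1r.
apply: bounded_measurableD => //.
by apply: bounded_measurableM => //; exact: bounded_measurable_cst.
Qed.

Lemma bounded_measurable_sum (I : Type) (r : seq I) (F : I -> T -> R) :
  (forall i, bounded_measurable (F i)) ->
  bounded_measurable (fun x => \sum_(i <- r) F i x).
Proof.
move=> mF; elim: r => [|i r IH].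
  by under eq_fun do rewrite big_nil; exact: bounded_measurable_cst.
by under eq_fun do rewrite big_cons; exact: bounded_measurableD.
Qed.

Lemma bounded_measurable_integrable f :
  bounded_measurable f -> mu.-integrable D (EFin \o f).
Proof.
move=> [mf [M fM]]; apply: measurable_bounded_integrable => //.
exists M; split; first exact: num_real.
by move=> x Mx y Dy; apply: le_trans (fM y Dy) (ltW Mx).
Qed.

Lemma Rintegral_sum (I : Type) (r : seq I) (F : I -> T -> R) :
  (forall i, bounded_measurable (F i)) ->
  \int[mu]_(x in D) (\sum_(i <- r) F i x) = \sum_(i <- r) \int[mu]_(x in D) F i x.
Proof.
move=> mF; elim: r => [|i r IH].
  under eq_Rintegral do rewrite big_nil.
  by rewrite big_nil Rintegral_cst// mul0r.
under eq_Rintegral do rewrite big_cons.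
rewrite big_cons -IH RintegralD//.
  exact: bounded_measurable_integrable.
by apply: bounded_measurable_integrable; exact: bounded_measurable_sum.
Qed.

Definition inner f g := \int[mu]_(x in D) (f x * g x).

Lemma innerC f g : inner f g = inner g f.
Proof. by apply: eq_Rintegral => x _; rewrite mulrC. Qed.

Lemma inner_suml (I : Type) (r : seq I) (c : I -> R) (F : I -> T -> R) g :
  (forall i, bounded_measurable (F i)) -> bounded_measurable g ->
  inner (fun x => \sum_(i <- r) c i * F i x) g = \sum_(i <- r) c i * inner (F i) g.
Proof.
move=> mF mg; rewrite /inner.
under eq_Rintegral do rewrite mulr_suml.
have mFg i : bounded_measurable (fun x => F i x * g x) by exact: bounded_measurableM.
rewrite Rintegral_sum => [|i]; last first.
  apply: bounded_measurableM => //; apply: bounded_measurableM => //.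
  exact: bounded_measurable_cst.
apply: eq_bigr => i _; under eq_Rintegral do rewrite -mulrA.
by rewrite RintegralZl//; exact: bounded_measurable_integrable.
Qed.

Lemma innerBl f g h :
  bounded_measurable f -> bounded_measurable g -> bounded_measurable h ->
  inner (fun x => f x - g x) h = inner f h - inner g h.
Proof.
move=> mf mg mh; rewrite /inner; under eq_Rintegral do rewrite mulrBl.
by rewrite RintegralB//; apply: bounded_measurable_integrable;
  exact: bounded_measurableM.
Qed.

Lemma innerZl c f g : bounded_measurable f -> bounded_measurable g ->
  inner (fun x => c * f x) g = c * inner f g.
Proof.
move=> mf mg; rewrite /inner; under eq_Rintegral do rewrite -mulrA.
by rewrite RintegralZl//; apply: bounded_measurable_integrable;
  exact: bounded_measurableM.
Qed.

(** Expand the integral of the square of f minus its orthogonal projection. *)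
Lemma bessel (I : finType) (phi : I -> T -> R) (n : I -> R) f :
  bounded_measurable f -> (forall i, bounded_measurable (phi i)) ->
  (forall i, 0 < n i) ->
  (forall i j, inner (phi i) (phi j) = if i == j then n i else 0) ->
  \sum_i inner f (phi i) ^+ 2 / n i <= \int[mu]_(x in D) f x ^+ 2.
Proof.
move=> mf mphi n0 orth.
pose c i := inner f (phi i) / n i.
pose g x := \sum_i c i * phi i x.
have mc i : bounded_measurable (fun x => c i * phi i x).
  by apply: bounded_measurableM => //; exact: bounded_measurable_cst.
have mg : bounded_measurable g by exact: bounded_measurable_sum.
have fg : inner g f = \sum_i inner f (phi i) ^+ 2 / n i.
  rewrite inner_suml//; apply: eq_bigr => i _.
  by rewrite innerC /c expr2 mulrAC.
have gg : inner g g = \sum_i inner f (phi i) ^+ 2 / n i.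
  rewrite inner_suml//; apply: eq_bigr => i _; rewrite innerC inner_suml//.
  rewrite (bigD1 i)//= big1 => [|j ji]; last by rewrite orth (negbTE ji) mulr0.
  by rewrite addr0 orth eqxx /c; field; rewrite gt_eqF.
have : 0 <= \int[mu]_(x in D) ((f x - g x) * (f x - g x)).
  by apply: Rintegral_ge0 => x _; rewrite -expr2 sqr_ge0.
under eq_Rintegral => x _.
  rewrite (_ : _ * _ = f x ^+ 2 - (2 * (g x * f x) - g x * g x)); last by ring.
  over.
have mgf : bounded_measurable (fun x => g x * f x) by exact: bounded_measurableM.
have mgg : bounded_measurable (fun x => g x * g x) by exact: bounded_measurableM.
have mff : bounded_measurable (fun x => f x ^+ 2).
  by under eq_fun do rewrite expr2; exact: bounded_measurableM.
have m2 : bounded_measurable (fun x => 2 * (g x * f x)).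
  by apply: bounded_measurableM => //; exact: bounded_measurable_cst.
rewrite RintegralB//; [|exact: bounded_measurable_integrable|]; last first.
  by apply: bounded_measurable_integrable; exact: bounded_measurableB.
rewrite RintegralB//; [|exact: bounded_measurable_integrable..].
rewrite RintegralZl//; last exact: bounded_measurable_integrable.
rewrite -/(inner g f) -/(inner g g) fg gg.
by set S := \sum_i _; rewrite mulr_natl mulr2n addrK subr_ge0.
Qed.

End BoundedMeasurable.

(** * Functions with separated variables *)

Section Tensor.
Context d1 d2 (T1 : measurableType d1) (T2 : measurableType d2) (R : realType).
Variables (m1 : {sigma_finite_measure set T1 -> \bar R})
  (m2 : {sigma_finite_measure set T2 -> \bar R}) (D1 : set T1) (D2 : set T2).
Hypotheses (mD1 : measurable D1) (mD2 : measurable D2).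
Hypotheses (m1D : (m1 D1 < +oo)%E) (m2D : (m2 D2 < +oo)%E).
Implicit Types (f : T1 -> R) (g : T2 -> R).

Lemma finite_measure_setX : ((m1 \x m2)%E (D1 `*` D2) < +oo)%E.
Proof. by rewrite product_measure1E// lte_mul_pinfty// ge0_fin_numE. Qed.

Definition tensor f g (z : T1 * T2) := f z.1 * g z.2.

Lemma bounded_measurable_tensor f g :
  bounded_measurable D1 f -> bounded_measurable D2 g ->
  bounded_measurable (D1 `*` D2) (tensor f g).
Proof.
move=> [mf [A fA]] [mg [B gB]]; apply: bounded_measurableM; split.
- apply: (measurable_comp (F := D1)) mf _ => //.
  + by move=> _ [z [z1 _] <-].
  + exact: measurable_funTS measurable_fst.
- by exists A => z [z1 _]; exact: fA.
- apply: (measurable_comp (F := D2)) mg _ => //.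
  + by move=> _ [z [_ z2] <-].
  + exact: measurable_funTS measurable_snd.
- by exists B => z [_ z2]; exact: gB.
Qed.

(** Fubini, applied to the functions extended by zero outside D1 and D2. *)
Lemma Rintegral_tensor f g :
  bounded_measurable D1 f -> bounded_measurable D2 g ->
  \int[(m1 \x m2)%E]_(z in D1 `*` D2) tensor f g z =
  (\int[m1]_(x in D1) f x) * (\int[m2]_(y in D2) g y).
Proof.
move=> mf mg.
have mD : measurable (D1 `*` D2) by exact: measurableX.
have imfg := bounded_measurable_integrable (mu := (m1 \x m2)%E) mD
  finite_measure_setX (bounded_measurable_tensor mf mg).
have imf := bounded_measurable_integrable mD1 m1D mf.
have img := bounded_measurable_integrable mD2 m2D mg.
have E x y : ((EFin \o tensor f g) \_ (D1 `*` D2) (x, y) =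
    ((EFin \o f) \_ D1) x * ((EFin \o g) \_ D2) y)%E.
  rewrite !patchE; have [xI|xI] := boolP (x \in D1).
    have [yI|yI] := boolP (y \in D2).
      by rewrite mem_set//; split; apply: set_mem.
    by rewrite memNset ?mule0// => -[_ /= /mem_set]; exact/negP.
  by rewrite memNset ?mul0e// => -[/= /mem_set + _]; exact/negP.
have finf : (\int[m1]_(x in D1) (f x)%:E)%E \is a fin_num by exact: integrable_fin_num.
have fing : (\int[m2]_(x in D2) (g x)%:E)%E \is a fin_num by exact: integrable_fin_num.
rewrite /Rintegral -fineM//; congr fine.
rewrite integral_mkcond -integral12_prod_meas1; last first.
  exact: (iffLR (integrable_mkcond _ mD) imfg).
rewrite /fubini_F/=; under eq_integral => x _.
  under eq_integral do rewrite E.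
  have -> : ((EFin \o f) \_ D1) x = ((f \_ D1) x)%:E by rewrite restrict_EFin.
  rewrite integralZl//; last exact: (iffLR (integrable_mkcond _ mD2) img).
  rewrite -integral_mkcond -[X in (_ * X)%E]fineK//.
  over.
rewrite integralZr//; last first.
  by have := iffLR (integrable_mkcond _ mD1) imf; rewrite restrict_EFin.
rewrite fineK//; congr (_ * _)%E; rewrite [RHS]integral_mkcond.
by apply: eq_integral => x _; rewrite restrict_EFin.
Qed.

Lemma inner_tensor f1 g1 f2 g2 :
  bounded_measurable D1 f1 -> bounded_measurable D2 g1 ->
  bounded_measurable D1 f2 -> bounded_measurable D2 g2 ->
  inner (m1 \x m2)%E (D1 `*` D2) (tensor f1 g1) (tensor f2 g2) =
  inner m1 D1 f1 f2 * inner m2 D2 g1 g2.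
Proof.
move=> *; rewrite -Rintegral_tensor; try exact: bounded_measurableM.
by apply: eq_Rintegral => z _; rewrite /tensor mulrACA.
Qed.

End Tensor.

(** * Steps on the unit interval *)

Section HaarSystem.
Variable R : realType.
Notation leb := (@lebesgue_measure R).
Notation I01 := (`[0, 1[%classic : set R).
(* The sigma-algebra is that of the Lebesgue measure. *)
Notation bounded_borel := (@bounded_measurable _ (measurableTypeR R) R).
Implicit Types (f : R -> R) (a b c p x : R) (j m : nat).

Lemma measurable_I01 : @measurable _ (measurableTypeR R) I01.
Proof. exact: measurable_itv. Qed.

Lemma finite_measure_I01 : (leb I01 < +oo)%E.
Proof. by rewrite lebesgue_measure_itv/= lte_fin ltr01 oppr0 adde0 ltry. Qed.

(** Haar functions are combinations of the functions [step a]; [above p] is the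
    trace in one coordinate of the counting part of the discrepancy.  The two
    differ at one point only. *)
Definition step a : R -> R := \1_`[a, +oo[.
Definition above p : R -> R := \1_`]p, +oo[.

Lemma bounded_borel_itv (D : set R) (i : interval R) :
  bounded_borel D (\1_[set` i] : R -> R).
Proof.
split; first by apply: measurable_indic; exact: measurable_itv.
by exists 1 => x _; rewrite indicE; case: (_ \in _); rewrite ?normr1 ?normr0.
Qed.

Lemma bounded_borel_step (D : set R) a : bounded_borel D (step a).
Proof. exact: bounded_borel_itv. Qed.

Lemma bounded_borel_above (D : set R) a : bounded_borel D (above a).
Proof. exact: bounded_borel_itv. Qed.

Lemma bounded_borel_id : bounded_borel I01 (fun x => x).
Proof.
split; first exact: measurable_id.
by exists 1 => x /=; rewrite in_itv/= => /andP[x0 x1]; rewrite ger0_norm// ltW.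
Qed.

Lemma inner_indic (A B : set R) : measurable A -> measurable B ->
  inner leb I01 \1_A \1_B = fine (leb (A `&` B `&` I01)).
Proof.
move=> mA mB; rewrite /inner /Rintegral.
under eq_integral do rewrite -[_ * _]/((\1_A \* \1_B) _) -indicI.
by rewrite integral_indic//; exact: measurableI.
Qed.

Lemma inner_step a b : 0 <= a <= 1 -> 0 <= b <= 1 ->
  inner leb I01 (step a) (step b) = 1 - Num.max a b.
Proof.
move=> a01 b01; rewrite inner_indic//.
have -> : `[a, +oo[ `&` `[b, +oo[ `&` I01 = `[Num.max a b, 1[%classic.
  apply/seteqP; split => x /=; rewrite !in_itv/= !andbT.
    by move=> [[xa xb] /andP[_ ->]]; rewrite ge_max xa xb.
  by rewrite ge_max => /andP[/andP[xa xb] x1]; rewrite xa xb x1; split => //; lra.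
rewrite lebesgue_measure_itv/= lte_fin; case: ifPn => //=.
by rewrite -leNgt le_max => ?; rewrite maxEle; case: ifP; lra.
Qed.

Lemma inner_above_step p a : 0 <= p <= 1 -> 0 <= a <= 1 ->
  inner leb I01 (above p) (step a) = 1 - Num.max p a.
Proof.
move=> p01 a01; rewrite inner_indic//.
have [pa|ap] := ltP p a.
  have -> : `]p, +oo[ `&` `[a, +oo[ `&` I01 = `[a, 1[%classic.
    apply/seteqP; split => x /=; rewrite !in_itv/= !andbT.
      by move=> [[xa xb] /andP[_ ->]]; rewrite xb.
    by move=> /andP[xa x1]; rewrite xa x1; split => //; lra.
  rewrite lebesgue_measure_itv/= lte_fin; case: ifPn => //=; lra.
have -> : `]p, +oo[ `&` `[a, +oo[ `&` I01 = `]p, 1[%classic.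
  apply/seteqP; split => x /=; rewrite !in_itv/= !andbT.
    by move=> [[xa xb] /andP[_ ->]]; rewrite xa.
  by move=> /andP[xa x1]; rewrite xa x1; split => //; lra.
by rewrite lebesgue_measure_itv/= lte_fin; case: ifPn => //=; lra.
Qed.

Lemma inner_id_step a : 0 <= a <= 1 ->
  inner leb I01 (fun x => x) (step a) = (1 - a ^+ 2) / 2.
Proof.
move=> /andP[a0 a1].
have -> : inner leb I01 (fun x => x) (step a) = \int[leb]_(x in `[a, 1[) x.
  have -> : `[a, 1[%classic = I01 `&` `[a, +oo[ :> set R.
    apply/seteqP; split => x /=; rewrite !in_itv/= !andbT.
      by move=> /andP[xa x1]; rewrite xa x1 (le_trans a0).
    by move=> [/andP[_ ->] ->].
  rewrite Rintegral_mkcondr; apply: eq_Rintegral => x _.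
  by rewrite patchE /step indicE; case: ifP; rewrite ?mulr1 ?mulr0.
move: a1; rewrite le_eqVlt => /predU1P[->|a1].
  by rewrite set_itvco0 Rintegral_set0 expr1n subrr mul0r.
rewrite Rintegral_itv_bndo_bndc; last first.
  have fin : (leb `[a, 1%R[%classic < +oo)%E.
    by rewrite lebesgue_measure_itv/= lte_fin a1 -EFinB ltry.
  apply: (bounded_measurable_integrable _ fin); first exact: measurable_itv.
  split; first exact: measurable_id.
  by exists 1 => x /=; rewrite in_itv/= => /andP[x0 x1]; rewrite ger0_norm; lra.
rewrite /Rintegral (@continuous_FTC2 _ _ (fun x => x ^+ 2 / 2))//=.
- by rewrite expr1n mulrBl.
- by apply: continuous_subspaceT => x; exact: cvg_id.
- split.
  + by move=> x _; apply: derivableM => //; exact: exprn_derivable.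
  + apply: cvg_at_right_filter; apply: cvgM; last exact: cvg_cst.
    exact: exprn_continuous.
  + apply: cvg_at_left_filter; apply: cvgM; last exact: cvg_cst.
    exact: exprn_continuous.
- move=> x _; rewrite (@derive1Mr _ (fun y : R => y ^+ 2))//.
  by rewrite derive1E exp_derive/= expr1 scaler1 mulrC mulrA mulVf ?mul1r// pnatr_eq0.
Qed.

End HaarSystem.

(** * Haar functions and the tent map *)

Section Haar.
Variable R : realType.
Notation leb := (@lebesgue_measure R).
Notation I01 := (`[0, 1[%classic : set R).
Notation bounded_borel := (@bounded_measurable _ (measurableTypeR R) R).
Implicit Types (f F : R -> R) (a b c p x : R) (j m k : nat).

Definition grid j k : R := k%:R / 2 ^+ j.+1.

(** The second difference of F over the dyadic interval [m 2^-j, (m+1) 2^-j].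
    Integrating against a Haar function is taking the second difference of the
    integrals against steps, so that all inner products below are second
    differences of the kernel 1 - max p a. *)
Definition diff2 j m F : R :=
  F (grid j m.*2) - 2 * F (grid j m.*2.+1) + F (grid j m.*2.+2).

Definition haar j m x := diff2 j m (fun a => step a x).

Lemma bounded_borel_haar (D : set R) j m : bounded_borel D (haar j m).
Proof.
apply: bounded_measurableD (bounded_borel_step _ _).
apply: bounded_measurableB (bounded_borel_step _ _) _.
by apply: bounded_measurableM (bounded_borel_step _ _); exact: bounded_measurable_cst.
Qed.

Lemma grid_itv j m k : (m < 2 ^ j)%N -> (k <= m.*2.+2)%N -> 0 <= grid j k <= 1.
Proof.
move=> mj km; rewrite /grid divr_ge0 ?exprn_ge0//= ler_pdivrMr ?exprn_gt0// mul1r.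
rewrite -natrX ler_nat (leq_trans km)// expnS mul2n -doubleS leq_double.
exact: mj.
Qed.

Lemma inner_haar f j m : bounded_borel I01 f ->
  inner leb I01 f (haar j m) = diff2 j m (fun a => inner leb I01 f (step a)).
Proof.
move=> mf.
have int g : bounded_borel I01 g -> leb.-integrable I01 (EFin \o g).
  move=> h; apply: (bounded_measurable_integrable _ (finite_measure_I01 R) h).
  exact: measurable_I01.
have mfs a : bounded_borel I01 (fun x => f x * step a x).
  by apply: bounded_measurableM => //; exact: bounded_borel_step.
have m2 a : bounded_borel I01 (fun x => 2 * (f x * step a x)).
  by apply: bounded_measurableM => //; exact: bounded_measurable_cst.
rewrite {1}/inner /haar /diff2.
under eq_Rintegral do rewrite mulrDr mulrBr mulrCA.
rewrite RintegralD ?RintegralB ?RintegralZl//; try exact: int; try exact: measurable_I01.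
by apply: int; exact: bounded_measurableB.
Qed.

Lemma grid_le j k l : (k <= l)%N -> grid j k <= grid j l.
Proof. by move=> kl; rewrite /grid ler_pM2r ?ler_nat// invr_gt0 exprn_gt0. Qed.

Lemma gridS j m : grid j m.+1 = grid j m + (2 ^+ j.+1)^-1.
Proof. by rewrite /grid -addn1 natrD mulrDl mul1r. Qed.

(** The function max c is affine on each side of c. *)
Lemma diff2_max j m c : c <= grid j m.*2 \/ grid j m.*2.+2 <= c ->
  diff2 j m (Num.max c) = 0.
Proof.
have lm := @grid_le j m.*2 m.*2.+1 (leqnSn _).
have mr := @grid_le j m.*2.+1 m.*2.+2 (leqnSn _).
move=> [h|h]; rewrite /diff2.
  by rewrite !max_r ?(le_trans h)// ?(le_trans lm)// !gridS; ring.
have h1 := le_trans mr h; have h2 := le_trans lm h1.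
by rewrite !max_l//; ring.
Qed.

Lemma grid_refine j n k : grid j k = grid (j + n) (k * 2 ^ n).
Proof.
by rewrite /grid -addSn exprD invfM natrM natrX mulrA mulrAC mulfK//.
Qed.

(** Dyadic intervals are nested or disjoint: the end points and the midpoint of
    one of them never lie strictly inside another one that is not longer. *)
Lemma grid_separated j m j' m' i : (j <= j')%N -> (j, m) != (j', m') -> (i <= 2)%N ->
  grid j (m.*2 + i) <= grid j' m'.*2 \/ grid j' m'.*2.+2 <= grid j (m.*2 + i).
Proof.
move=> /subnKC <-; move: (j' - j)%N => n ne i2; rewrite (@grid_refine j n).
suff [h|h] : ((m.*2 + i) * 2 ^ n <= m'.*2)%N \/ (m'.*2.+2 <= (m.*2 + i) * 2 ^ n)%N.
- by left; exact: grid_le.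
- by right; exact: grid_le.
case: n ne => [|n] ne.
  have {}ne : m != m' by apply: contraNneq ne => ->; rewrite addn0.
  by rewrite muln1; move: ne; rewrite neq_ltn => /orP[] ?; [left|right]; lia.
rewrite expnS mulnCA mul2n -doubleS !leq_double; move: (_ * _)%N => X.
by case: (leqP X m'); [left|right].
Qed.

(** The inner product is an iterated second difference of the kernel.  For
    different indices every node of the coarser interval sees the finer one from
    outside, where the kernel is affine. *)
Lemma inner_haar_haar j m j' m' :
  (m < 2 ^ j)%N -> (m' < 2 ^ j')%N ->
  inner leb I01 (haar j m) (haar j' m') =
    if (j, m) == (j', m') then (2 ^+ j)^-1 else 0.
Proof.
wlog jj : j m j' m' / (j <= j')%N.
  move=> H mj mj'; have [jj|/ltnW jj] := leqP j j'; first exact: H.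
  by rewrite innerC H// eq_sym; case: eqP => // -[->].
move=> mj mj'.
have -> : inner leb I01 (haar j m) (haar j' m') =
    - diff2 j m (fun b => diff2 j' m' (Num.max b)).
  rewrite innerC inner_haar; last exact: bounded_borel_haar.
  rewrite /diff2 ![inner leb I01 (haar _ _) _]innerC !inner_haar; try exact: bounded_borel_step.
  rewrite /diff2 !inner_step ?(grid_itv mj) ?(grid_itv mj')//; try lia.
  by ring.
have [[<- <-]|/eqP ne] := eqVneq (j, m) (j', m').
  rewrite {1}/diff2 [diff2 j m (Num.max (grid j m.*2))]diff2_max; last by left.
  rewrite [diff2 j m (Num.max (grid j m.*2.+2))]diff2_max; last by right.
  have := @grid_le j m.*2 m.*2.+1 (leqnSn _).
  have := @grid_le j m.*2.+1 m.*2.+2 (leqnSn _).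
  rewrite /diff2 => h1 h2; rewrite max_l// maxxx max_r// !gridS /grid.
  by rewrite exprS; field; rewrite expf_neq0// pnatr_eq0.
have sep i : (i <= 2)%N -> diff2 j' m' (Num.max (grid j (m.*2 + i))) = 0.
  by move=> i2; apply: diff2_max; apply: grid_separated => //; exact/eqP.
have := sep 0%N isT; have := sep 1%N isT; have := sep 2%N isT.
rewrite addn0 addn1 addn2 => h1 h2 h3; rewrite {1}/diff2 h1 h2 h3; ring.
Qed.

(** The normalised second difference of the kernel: a piecewise affine bump of
    height 1 supported by the dyadic interval. *)
Definition hat j m p : R := diff2 j m (Num.max p) * 2 ^+ j.+1.

Lemma inner_above_haar j m p : (m < 2 ^ j)%N -> 0 <= p <= 1 ->
  inner leb I01 (above p) (haar j m) = - hat j m p / 2 ^+ j.+1.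
Proof.
move=> mj p01; rewrite inner_haar; last exact: bounded_borel_above.
rewrite /diff2 !inner_above_step ?(grid_itv mj)//; try lia.
by rewrite /hat mulNr mulfK ?expf_neq0 ?pnatr_eq0// /diff2; ring.
Qed.

Lemma inner_id_haar j m : (m < 2 ^ j)%N ->
  inner leb I01 (fun x => x) (haar j m) = - (2 ^+ j.+1)^-2.
Proof.
move=> mj; rewrite inner_haar; last exact: bounded_borel_id.
rewrite /diff2 !inner_id_step ?(grid_itv mj)//; try lia.
by rewrite !gridS; field; rewrite expf_neq0// pnatr_eq0.
Qed.

Lemma grid_even j m : grid j m.*2 = m%:R / 2 ^+ j.
Proof. by rewrite /grid -muln2 natrM exprS invfM mulrA mulfK// pnatr_eq0. Qed.

Lemma hat_out j m p : 2 ^+ j * p <= m%:R \/ m.+1%:R <= 2 ^+ j * p ->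
  hat j m p = 0.
Proof.
move=> h; rewrite /hat diff2_max ?mul0r// -doubleS !grid_even.
by rewrite ler_pdivlMr ?ler_pdivrMr ?exprn_gt0// !(mulrC p).
Qed.

Lemma hat_tent j m p : m%:R <= 2 ^+ j * p <= m.+1%:R ->
  hat j m p = tent (2 ^+ j * p - m%:R).
Proof.
set w := _ - _ => /andP[mp pm].
have e0 : 2 ^+ j != 0 :> R by rewrite expf_neq0// pnatr_eq0.
have -> : p = grid j m.*2 + 2 * w * (2 ^+ j.+1)^-1.
  by rewrite grid_even exprS /w; field; rewrite e0.
have w01 : 0 <= w <= 1 by rewrite subr_ge0 mp /= lerBlDl natr1.
rewrite /hat /diff2 !gridS; move: (grid j _) => l.
have d0 : 0 < (2 ^+ j.+1 : R)^-1 by rewrite invr_gt0 exprn_gt0.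
have dd : 2 ^+ j.+1 = ((2 ^+ j.+1 : R)^-1)^-1 by rewrite invrK.
rewrite [X in _ * X = _]dd; move: (_^-1) d0 => d d0.
rewrite (@max_l _ _ _ l); last by nra.
rewrite (@max_r _ _ _ (l + d + d)); last by nra.
have [h|h] := leP w (1/2).
  rewrite tent_left// max_r; last by nra.
  by field; rewrite gt_eqF.
rewrite tent_right ?ltW// max_l; last by nra.
by field; rewrite gt_eqF.
Qed.

(** The iterate of order j of the tent map sends each dyadic interval of length
    2^-j affinely onto [0, 1], with either orientation; one more iterate does not
    see the orientation, by [tent_sym]. *)
Lemma iter_tent_dyadic j m p : (m < 2 ^ j)%N -> m%:R <= 2 ^+ j * p <= m.+1%:R ->
  iter j.+1 (@tent R) p = tent (2 ^+ j * p - m%:R).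
Proof.
elim: j m => [|j IH] m mj.
  by case: m mj => // _; rewrite mul1r subr0.
rewrite exprS; set y := 2 ^+ j * p; rewrite -mulrA -/y => /andP[my ym].
have hm : m%:R = (odd m)%:R + 2 * (m./2)%:R :> R.
  by rewrite -[in LHS](odd_double_half m) natrD -mul2n natrM.
have h2 : (m./2 < 2 ^ j)%N by move: mj; rewrite expnS; lia.
rewrite -(@natr1 _ m) in ym; rewrite iterS (IH m./2) -/y//; last first.
  by rewrite -(@natr1 _ m./2); move: my ym; rewrite hm; case: (odd m) => /=; lra.
move: my ym; rewrite hm; case: (odd m) => /= my ym.
  rewrite (@tent_right _ (y - _)); last by lra.
  by rewrite -tent_sym; congr tent; lra.
by rewrite (@tent_left _ (y - _)); [congr tent; lra|lra].
Qed.

(** At each level a point is seen by the bump of its own dyadic interval only,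
    at the height given by its orbit under the tent map. *)
Lemma hat_local j p : 0 <= p < 1 -> exists m0 : 'I_(2 ^ j), forall m : 'I_(2 ^ j),
  hat j m p = if m == m0 then iter j.+1 (@tent R) p else 0.
Proof.
move=> /andP[p0 p1].
have e0 : 0 < 2 ^+ j :> R by rewrite exprn_gt0.
have y0 : 0 <= 2 ^+ j * p by rewrite mulr_ge0// ltW.
have /andP[ky yk] := Num.Theory.truncn_itv y0.
set k := Num.truncn _ in ky yk.
have kj : (k < 2 ^ j)%N.
  by rewrite -(ltr_nat R) natrX (le_lt_trans ky)// gtr_pMr.
exists (Ordinal kj) => m; case: eqP => [->|/eqP mk].
  by rewrite (@hat_tent j k) ?(@iter_tent_dyadic j k)// ky ltW.
apply: hat_out; move: mk; rewrite -val_eqE neq_ltn /= => /orP[mk|km].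
  by right; apply: le_trans ky; rewrite ler_nat.
by left; apply: le_trans (ltW yk) _; rewrite ler_nat.
Qed.

End Haar.

(** * The Haar coefficients of one shape *)

Section Energy.
Variable R : realType.
Implicit Types (pts : seq (R * R)) (j k m : nat).

Definition tent_orbit j (x : R) : R := iter j.+1 (@tent R) x.

Lemma tent_orbit_itv j x : 0 <= x < 1 -> 0 <= tent_orbit j x <= 1.
Proof.
case/andP=> x0 /ltW x1; rewrite /tent_orbit; elim: j.+1 => [|i IH] /=.
  by rewrite x0 x1.
exact: tent_itv.
Qed.

Lemma sum_hat j x : 0 <= x < 1 -> \sum_(m < 2 ^ j) hat j m x = tent_orbit j x.
Proof.
move=> /(hat_local j)[m0 E]; rewrite (bigD1 m0)//= E eqxx big1 ?addr0// => m mm.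
by rewrite E (negbTE mm).
Qed.

Lemma sum_sqr_hat j x : 0 <= x < 1 ->
  \sum_(m < 2 ^ j) hat j m x ^+ 2 = tent_orbit j x ^+ 2.
Proof.
move=> /(hat_local j)[m0 E]; rewrite (bigD1 m0)//= E eqxx big1 ?addr0// => m mm.
by rewrite E (negbTE mm) expr0n.
Qed.

Lemma hat_ge0 j (m : 'I_(2 ^ j)) (x : R) : 0 <= x < 1 -> 0 <= hat j m x.
Proof.
move=> x01; have [m0 ->] := hat_local j x01; case: ifP => // _.
by have /andP[] := tent_orbit_itv j x01.
Qed.

Lemma sum_sqr_le (I : eqType) (r : seq I) (F : I -> R) :
  (forall i, i \in r -> 0 <= F i) ->
  \sum_(i <- r) F i ^+ 2 <= (\sum_(i <- r) F i) ^+ 2.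
Proof.
elim: r => [|i r IH] F0; first by rewrite !big_nil expr0n.
rewrite !big_cons sqrrD -addrA lerD2l.
apply: le_trans (IH _) _ => [k kr|]; first by rewrite F0// inE kr orbT.
rewrite lerDr mulrn_wge0// mulr_ge0 ?F0 ?inE ?eqxx//.
by rewrite big_seq sumr_ge0// => k kr; rewrite F0// inE kr orbT.
Qed.

Lemma sum_cell_energy (I : Type) (r : seq I) (s : R) (F : I -> R) :
  \sum_(i <- r) cell_energy s (F i) = (size r)%:R * (s ^+ 2 / 16)
    + s * (\sum_(i <- r) F i ^+ 2) - s ^+ 2 / 2 * (\sum_(i <- r) F i).
Proof.
elim: r => [|i r IH]; first by rewrite !big_nil /=; ring.
by rewrite !big_cons IH /= -(@natr1 _ (size r)) /cell_energy; field.
Qed.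

Definition in_square (p : R * R) := (0 <= p.1 < 1) && (0 <= p.2 < 1).

(** The sum of the squared normalised Haar coefficients of the discrepancy over
    all boxes of shape 2^-j1 x 2^-j2. *)
Definition haar_energy pts j1 j2 : R :=
  (\sum_(m1 < 2 ^ j1) \sum_(m2 < 2 ^ j2)
     (\sum_(p <- pts) hat j1 m1 p.1 * hat j2 m2 p.2
      - (size pts)%:R / 2 ^+ (j1 + j2).+2) ^+ 2) / 2 ^+ (j1 + j2) / 16.

Lemma haar_energy_ge0 pts j1 j2 : 0 <= haar_energy pts j1 j2.
Proof.
rewrite /haar_energy !divr_ge0 ?exprn_ge0//.
by apply: sumr_ge0 => m1 _; apply: sumr_ge0 => m2 _; exact: sqr_ge0.
Qed.

(** Expand the squares: the points of a box enter through S and S^2, and S^2 is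
    at least the sum of the squares of its nonnegative terms.  What remains is a
    sum over the points, without any reference to the boxes that contain them.
    Equality holds when no box contains two points. *)
Lemma haar_energy_ge pts j1 j2 : (0 < size pts)%N -> all in_square pts ->
  (\sum_(p <- pts) cell_energy ((size pts)%:R / 2 ^+ (j1 + j2))
     (tent_orbit j1 p.1 * tent_orbit j2 p.2)) / (size pts)%:R / 16
  <= haar_energy pts j1 j2.
Proof.
move=> N0 /allP sq; set N : R := (size pts)%:R.
have {}N0 : 0 < N by rewrite ltr0n.
set q : R := 2 ^+ (j1 + j2); have q0 : 0 < q by rewrite exprn_gt0.
pose S m1 m2 := \sum_(p <- pts) hat j1 m1 p.1 * hat j2 m2 p.2.
pose t (p : R * R) := tent_orbit j1 p.1 * tent_orbit j2 p.2.
have sumS : \sum_(m1 < 2 ^ j1) \sum_(m2 < 2 ^ j2) S m1 m2 = \sum_(p <- pts) t p.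
  under eq_bigr => m1 _ do rewrite exchange_big /=.
  rewrite exchange_big /=; apply: eq_big_seq => p /sq /andP[p1 p2].
  under eq_bigr => m1 _ do rewrite -mulr_sumr sum_hat//.
  by rewrite -mulr_suml sum_hat.
have sumS2 : \sum_(p <- pts) t p ^+ 2 <=
    \sum_(m1 < 2 ^ j1) \sum_(m2 < 2 ^ j2) S m1 m2 ^+ 2.
  have -> : \sum_(p <- pts) t p ^+ 2 = \sum_(m1 < 2 ^ j1) \sum_(m2 < 2 ^ j2)
      \sum_(p <- pts) (hat j1 m1 p.1 * hat j2 m2 p.2) ^+ 2.
    under [RHS]eq_bigr => m1 _ do rewrite exchange_big /=.
    rewrite [RHS]exchange_big /=; apply: eq_big_seq => p /sq /andP[p1 p2].
    under eq_bigr => m1 _.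
      under eq_bigr do rewrite exprMn.
      rewrite -mulr_sumr sum_sqr_hat//.
      over.
    by rewrite -mulr_suml sum_sqr_hat// exprMn.
  apply: ler_sum => m1 _; apply: ler_sum => m2 _; apply: sum_sqr_le => p /sq.
  by case/andP=> p1 p2; rewrite mulr_ge0// hat_ge0.
rewrite /haar_energy ler_pM2r ?invr_gt0// -/N -/q.
rewrite [2 ^+ _.+2](_ : _ = 4 * q); last by rewrite /q !exprS; ring.
have -> : \sum_(m1 < 2 ^ j1) \sum_(m2 < 2 ^ j2) (S m1 m2 - N / (4 * q)) ^+ 2 =
   \sum_(m1 < 2 ^ j1) \sum_(m2 < 2 ^ j2) S m1 m2 ^+ 2
   - 2 * (N / (4 * q)) * \sum_(p <- pts) t p + q * (N / (4 * q)) ^+ 2.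
  rewrite -sumS.
  under eq_bigr => m1 _.
    under eq_bigr => m2 _ do rewrite sqrrB -mulrnAr (mulrC (S _ _)).
    rewrite big_split sumrB /= -mulr_sumr sumr_const card_ord.
    over.
  rewrite big_split sumrB /= -mulr_sumr sumr_const card_ord.
  set a := N / _; have -> : a ^+ 2 *+ 2 ^ j2 *+ 2 ^ j1 = q * a ^+ 2.
    by rewrite -mulrnA -expnD addnC -[LHS]mulr_natl natrX.
  by ring.
apply: (@le_trans _ _ ((\sum_(p <- pts) t p ^+ 2
   - 2 * (N / (4 * q)) * \sum_(p <- pts) t p + q * (N / (4 * q)) ^+ 2) / q)).
  2: by rewrite ler_pM2r ?invr_gt0// !lerD2r.
rewrite le_eqVlt; apply/orP; left; apply/eqP.
by rewrite sum_cell_energy -/N; field; rewrite !gt_eqF.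
Qed.

End Energy.

(** * Summation over stencils *)

Section Stencils.
Variable R : realType.

Definition diagonal (K k : nat) (B : nat -> nat -> R) : R :=
  \sum_(j1 < K) \sum_(j2 < K | (j1 + j2 == k)%N) B j1 j2.

(** The k + 1 shapes of level k, shifted by (a, b), are distinct shapes of level
    k + a + b. *)
Lemma shifted_diagonal_le (B : nat -> nat -> R) K k a b :
  (forall i j, 0 <= B i j) -> (k + a < K)%N -> (k + b < K)%N ->
  \sum_(i < k.+1) B (i + a)%N (k - i + b)%N <= diagonal K (k + a + b) B.
Proof.
move=> B0 aK bK.
pose G j1 := \sum_(j2 < K | (j1 + j2 == k + a + b)%N) B j1 j2.
have G0 j1 : 0 <= G j1 by exact: sumr_ge0.
rewrite /diagonal -(big_mkord xpredT G).
rewrite (@big_cat_nat _ _ _ a)//=; last by lia.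
rewrite (@big_cat_nat _ _ _ (k.+1 + a) a)//=; try lia.
rewrite addrA -[leLHS]add0r -[leLHS]addr0 lerD ?lerD ?sumr_ge0//.
rewrite -{2}[a]add0n big_addn addnK big_mkord.
apply: ler_sum => i _; rewrite /G.
have jK : (k - i + b < K)%N by lia.
rewrite (bigD1 (Ordinal jK)) /=; last by have := ltn_ord i; lia.
by rewrite lerDl sumr_ge0.
Qed.

(** At the first refinement the two shifts of level k are averaged, at the second
    refinement the three shifts are; each of them is a part of its level. *)
Lemma sum_stencils_le (B : nat -> nat -> R) k : (forall i j, 0 <= B i j) ->
  \sum_(i < k.+1) (B i (k - i)%N
    + (B i.+1 (k - i)%N + B i (k - i).+1) / 2
    + (B i.+2 (k - i)%N + B i.+1 (k - i).+1 + B i (k - i).+2) / 3)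
  <= \sum_(j1 < k.+3) \sum_(j2 < k.+3) B j1 j2.
Proof.
move=> B0; pose L e := diagonal k.+3 (k + e) B.
have sh a b (F : nat -> R) : (a + b <= 2)%N ->
    (forall i, F i = B (i + a)%N (k - i + b)%N) -> \sum_(i < k.+1) F i <= L (a + b)%N.
  move=> ab FE; under eq_bigr do rewrite FE.
  by rewrite /L addnA; apply: shifted_diagonal_le => //; lia.
have total : L 0%N + L 1%N + L 2%N <= \sum_(j1 < k.+3) \sum_(j2 < k.+3) B j1 j2.
  pose ind e j1 j2 := if (j1 + j2 == k + e)%N then B j1 j2 else 0.
  have LE e : L e = \sum_(j1 < k.+3) \sum_(j2 < k.+3) ind e j1 j2.
    by apply: eq_bigr => j1 _; rewrite big_mkcond.
  apply: (@le_trans _ _ (\sum_(j1 < k.+3) \sum_(j2 < k.+3)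
      (ind 0%N j1 j2 + ind 1%N j1 j2 + ind 2%N j1 j2))).
    rewrite !LE le_eqVlt; apply/orP; left; apply/eqP.
    under [RHS]eq_bigr do rewrite !big_split /=.
    by rewrite !big_split.
  apply: ler_sum => j1 _; apply: ler_sum => j2 _; rewrite /ind.
  have := B0 j1 j2; rewrite addn0 addn1 addn2.
  case: eqP => [->|_]; first by rewrite !ltn_eqF// !addr0.
  by case: eqP => [->|_]; case: eqP => // *; rewrite ?addr0 ?add0r//; lia.
apply: le_trans total.
have L0 : \sum_(i < k.+1) B i (k - i)%N <= L 0%N.
  by apply: (sh 0%N 0%N (fun i => B i (k - i)%N)) => // i; rewrite !addn0.
have L1 : \sum_(i < k.+1) (B i.+1 (k - i)%N + B i (k - i).+1) / 2 <= L 1%N.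
  rewrite -mulr_suml ler_pdivrMr// mulr_natr mulr2n big_split /= lerD//.
    by apply: (sh 1%N 0%N (fun i => B i.+1 (k - i)%N)) => // i; rewrite addn0 addn1.
  by apply: (sh 0%N 1%N (fun i => B i (k - i).+1%N)) => // i; rewrite addn0 addn1.
rewrite !big_split /= lerD ?lerD// -mulr_suml ler_pdivrMr// mulr_natr.
rewrite !mulrS mulr0n addr0 !big_split /= addrA !lerD//.
- by apply: (sh 2%N 0%N (fun i => B i.+2 (k - i)%N)) => // i; rewrite addn0 addn2.
- by apply: (sh 1%N 1%N (fun i => B i.+1 (k - i).+1%N)) => // i; rewrite !addn1.
- by apply: (sh 0%N 2%N (fun i => B i (k - i).+2%N)) => // i; rewrite addn0 addn2.
Qed.

End Stencils.

(** * The Haar coefficients of the discrepancy *)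

Section HaarCoefficients.
Variable R : realType.
Notation leb := (@lebesgue_measure R).
Notation leb2 := (leb \x leb)%E.
Notation I01 := (`[0, 1[%classic : set R).
Notation bounded_borel := (@bounded_measurable _ (measurableTypeR R) R I01).
Notation bounded_borel2 :=
  (@bounded_measurable _ (measurableTypeR R * measurableTypeR R)%type R (@unit_square R)).
Notation inner2 := (inner leb2 (@unit_square R)).
Implicit Types (P : {fset R * R}) (f g : R -> R).

Lemma measurable_unit_square :
  @measurable _ (measurableTypeR R * measurableTypeR R)%type (@unit_square R).
Proof. by apply: measurableX; exact: measurable_itv. Qed.

Lemma finite_measure_unit_square : (leb2 (@unit_square R) < +oo)%E.
Proof.
apply: finite_measure_setX; try exact: measurable_I01; exact: finite_measure_I01.
Qed.

Lemma bounded_tensor f g : bounded_borel f -> bounded_borel g ->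
  bounded_borel2 (tensor f g).
Proof. by apply: bounded_measurable_tensor; exact: measurable_I01. Qed.

Lemma inner2_tensor f1 g1 f2 g2 : bounded_borel f1 -> bounded_borel g1 ->
  bounded_borel f2 -> bounded_borel g2 ->
  inner2 (tensor f1 g1) (tensor f2 g2) = inner leb I01 f1 f2 * inner leb I01 g1 g2.
Proof.
by apply: inner_tensor; try exact: measurable_I01; exact: finite_measure_I01.
Qed.

(** The sums of products of functions of one variable are what Fubini's theorem
    handles; [discrepancyE] identifies this one with the discrepancy. *)
Definition tensor_discrepancy P (x : R * R) : R :=
  \sum_(p <- P) 1 * tensor (above p.1) (above p.2) x
  - #|` P|%:R * tensor (fun t => t) (fun t => t) x.

Lemma discrepancyE P x : [set` P] `<=` unit_square (R:=R) ->
  discrepancy P x = tensor_discrepancy P x.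
Proof.
move=> sq; rewrite /discrepancy /tensor_discrepancy /tensor mulrA; congr (_ - _).
apply: eq_big_seq => p /sq [/= p1 p2]; rewrite mul1r /above !indicE.
rewrite -natrM mulnb; congr (_%:R); congr nat_of_bool.
move: p1 p2; rewrite /= !in_itv/= => /andP[p1 _] /andP[p2 _].
apply/idP/idP => [/set_mem[/=]|/andP[/set_mem /= + /set_mem /=]].
  rewrite !in_itv/= => /andP[_ h1] /andP[_ h2].
  by rewrite !mem_set//= in_itv/= andbT.
by rewrite !in_itv/= !andbT => h1 h2; rewrite mem_set//; split; rewrite /= in_itv/= ?p1 ?p2.
Qed.

Lemma bounded_tensor_discrepancy P : bounded_borel2 (tensor_discrepancy P).
Proof.
apply: bounded_measurableB.
  apply: bounded_measurable_sum => p; apply: bounded_measurableM.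
    exact: bounded_measurable_cst.
  by apply: bounded_tensor; exact: bounded_borel_above.
apply: bounded_measurableM; first exact: bounded_measurable_cst.
by apply: bounded_tensor; exact: bounded_borel_id.
Qed.

Lemma inner_discrepancy_haar P j1 m1 j2 m2 : all (@in_square R) P ->
  (m1 < 2 ^ j1)%N -> (m2 < 2 ^ j2)%N ->
  inner2 (tensor_discrepancy P) (tensor (haar j1 m1) (haar j2 m2)) =
  (\sum_(p <- P) hat j1 m1 p.1 * hat j2 m2 p.2 - #|` P|%:R / 2 ^+ (j1 + j2).+2)
  / 2 ^+ (j1 + j2).+2.
Proof.
move=> /allP sq mj1 mj2.
have mabove (p : R * R) : bounded_borel2 (tensor (above p.1) (above p.2)).
  by apply: bounded_tensor; exact: bounded_borel_above.
have mid : bounded_borel2 (tensor (fun t : R => t) (fun t : R => t)).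
  by apply: bounded_tensor; exact: bounded_borel_id.
have mh : bounded_borel2 (tensor (haar j1 m1) (haar j2 m2)).
  by apply: bounded_tensor; exact: bounded_borel_haar.
have mD := measurable_unit_square; have fD := finite_measure_unit_square.
rewrite /tensor_discrepancy innerBl//; first last.
- by apply: bounded_measurableM => //; exact: bounded_measurable_cst.
- apply: bounded_measurable_sum => p; apply: bounded_measurableM => //.
  exact: bounded_measurable_cst.
rewrite inner_suml// innerZl// inner2_tensor; try exact: bounded_borel_id;
  try exact: bounded_borel_haar.
rewrite !inner_id_haar// mulrBl mulr_suml; congr (_ - _).
  apply: eq_big_seq => p /sq /andP[/andP[p1 /ltW p1'] /andP[p2 /ltW p2']].
  rewrite mul1r inner2_tensor; try exact: bounded_borel_above;
    try exact: bounded_borel_haar.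
  rewrite !inner_above_haar ?p1 ?p2//.
  by rewrite -addSn -addnS exprD invfM; ring.
rewrite -addSn -addnS exprD.
have e0 j : 2 ^+ j.+1 != 0 :> R by rewrite expf_neq0// pnatr_eq0.
by move: (_ ^+ j1.+1) (_ ^+ j2.+1) (e0 j1) (e0 j2) => a b a0 b0; field; rewrite a0 b0.
Qed.

(** Bessel's inequality for the products of Haar functions of levels below K. *)
Lemma sum_haar_energy_le K P : [set` P] `<=` unit_square (R:=R) ->
  \sum_(j1 < K) \sum_(j2 < K) haar_energy P j1 j2 <=
  \int[leb2]_(x in @unit_square R) discrepancy P x ^+ 2.
Proof.
move=> sq.
have sq' : all (@in_square R) P.
  by apply/allP => p /sq [/=]; rewrite !in_itv /in_square => -> ->.
under eq_Rintegral do rewrite discrepancyE//.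
pose J := {j : 'I_K & 'I_(2 ^ j)}.
pose h (a : J) := haar (tag a) (tagged a) : R -> R.
pose phi (a : J * J) := tensor (h a.1) (h a.2).
pose n (a : J * J) : R := (2 ^+ tag a.1)^-1 * (2 ^+ tag a.2)^-1.
have mh a : bounded_borel (h a) by exact: bounded_borel_haar.
have orth a b : inner leb I01 (h a) (h b) = if a == b then (2 ^+ tag a)^-1 else 0.
  rewrite inner_haar_haar; try exact: ltn_ord.
  congr (if _ then _ else _); apply/eqP/eqP => [|->//].
  case: a b => [j m] [j' m'] /= [/ord_inj jj].
  by subst j' => /ord_inj ->.
have := @bessel _ _ _ leb2 _ measurable_unit_square finite_measure_unit_square
  _ phi n (tensor_discrepancy P) (bounded_tensor_discrepancy P) _ _ _.
move=> B; apply: le_trans (B _ _ _); last first.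
- move=> [a1 a2] [b1 b2]; rewrite /phi /= inner2_tensor// !orth xpair_eqE.
  by case: eqP => _; case: eqP => _; rewrite ?mul0r ?mulr0.
- by move=> a; rewrite /n mulr_gt0 ?invr_gt0 ?exprn_gt0.
- by move=> a; exact: bounded_tensor.
rewrite le_eqVlt; apply/orP; left; apply/eqP.
have sumJ (G : nat -> nat -> R) :
    \sum_(a : J) G (tag a) (tagged a) = \sum_(j < K) \sum_(m < 2 ^ j) G j m.
  by rewrite (sig_big_dep _ _ (fun (j : 'I_K) (m : 'I_(2 ^ j)) => G j m)).
pose F j1 m1 j2 m2 := (\sum_(p <- P) hat j1 m1 p.1 * hat j2 m2 p.2
  - #|` P|%:R / 2 ^+ (j1 + j2).+2) ^+ 2 / 2 ^+ (j1 + j2) / 16.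
transitivity (\sum_(a : J) \sum_(b : J)
    F (tag a) (tagged a) (tag b) (tagged b)).
  rewrite (sumJ (fun j1 m1 => \sum_(b : J) F j1 m1 (tag b) (tagged b))).
  apply: eq_bigr => j1 _; under [RHS]eq_bigr do rewrite (sumJ (F j1 _)).
  rewrite [RHS]exchange_big /=; apply: eq_bigr => j2 _.
  rewrite /haar_energy !mulr_suml; apply: eq_bigr => m1 _.
  by rewrite !mulr_suml.
rewrite pair_bigA /=; apply: eq_bigr => -[a b] _ /=.
rewrite /phi /h /n /F /= inner_discrepancy_haar//.
rewrite !exprS exprD.
have e0 j : 2 ^+ j != 0 :> R by rewrite expf_neq0// pnatr_eq0.
move: (_ ^+ tag a) (_ ^+ tag b) (e0 (tag a)) (e0 (tag b)) => x y x0 y0.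
by move: (\sum_(p <- P) _) => S; field; rewrite x0 y0.
Qed.

End HaarCoefficients.

(** * The lower bound at a given dyadic scale *)

Section LowerBound.
Variable R : realType.
Notation leb := (@lebesgue_measure R).
Implicit Types (P : {fset R * R}) (g c : R) (k N : nat).

Lemma sum_stencil (I : Type) (r : seq I) (f a b x y z : I -> R) :
  \sum_(i <- r) (f i + (a i + b i) / 2 + (x i + y i + z i) / 3) =
  \sum_(i <- r) f i + (\sum_(i <- r) a i + \sum_(i <- r) b i) / 2
  + (\sum_(i <- r) x i + \sum_(i <- r) y i + \sum_(i <- r) z i) / 3.
Proof. by rewrite !big_split -!mulr_suml !big_split. Qed.

(** Place a stencil at each of the k + 1 shapes of level k.  Inside a stencil the
    heights of a point are tent iterates of those at its first shape, so each
    stencil brings at least g / 16, on average over the points. *)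
Lemma integral_discrepancy_ge P N k g : (0 < N)%N -> point_sets N P ->
  (forall u v, 0 <= u <= 1 -> 0 <= v <= 1 -> g <= stencil_energy (N%:R / 2 ^+ k) u v) ->
  k.+1%:R * (g / 16) <=
  \int[(leb \x leb)%E]_(x in @unit_square R) discrepancy P x ^+ 2.
Proof.
move=> N0 [sq PN] gst.
have sqP : all (@in_square R) P.
  by apply/allP => p /sq [/=]; rewrite !in_itv /in_square => -> ->.
apply: le_trans (sum_haar_energy_le k.+3 sq).
apply: le_trans (sum_stencils_le _ (haar_energy_ge0 P)).
rewrite mulr_natl -[X in _ *+ X]card_ord -sumr_const; apply: ler_sum => i _.
pose s : R := N%:R / 2 ^+ k.
pose E j1 j2 e := (\sum_(p <- P) cell_energy (s / 2 ^+ e)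
     (tent_orbit j1 p.1 * tent_orbit j2 p.2)) / N%:R / 16.
have EB j1 j2 e : (j1 + j2 = k + e)%N -> E j1 j2 e <= haar_energy P j1 j2.
  move=> jj; have := @haar_energy_ge _ P j1 j2; rewrite PN => /(_ N0 sqP).
  by rewrite jj exprD invfM mulrA.
have ik : (i <= k)%N by rewrite -ltnS.
apply: (@le_trans _ _ (E i (k - i)%N 0%N + (E i.+1 (k - i)%N 1%N + E i (k - i).+1 1%N) / 2
    + (E i.+2 (k - i)%N 2%N + E i.+1 (k - i).+1 2%N + E i (k - i).+2 2%N) / 3)); last first.
  apply: lerD; [apply: lerD; [apply: EB; lia|]|];
    by rewrite ler_pM2r ?invr_gt0//; repeat apply: lerD; apply: EB; lia.
have -> : E i (k - i)%N 0%N + (E i.+1 (k - i)%N 1%N + E i (k - i).+1 1%N) / 2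
    + (E i.+2 (k - i)%N 2%N + E i.+1 (k - i).+1 2%N + E i (k - i).+2 2%N) / 3 =
    (\sum_(p <- P) stencil_energy s (tent_orbit i p.1) (tent_orbit (k - i) p.2))
      / N%:R / 16.
  have tentE j x : tent (tent_orbit j x) = tent_orbit j.+1 x :> R by [].
  under [in RHS]eq_bigr do rewrite /stencil_energy !tentE.
  rewrite sum_stencil /E expr0 divr1 expr1 (_ : 2 ^+ 2 = 4); last by ring.
  by field; rewrite pnatr_eq0 -lt0n.
rewrite ler_pM2r// ler_pdivlMr ?ltr0n// -PN -sum1_size natr_sum mulr_sumr.
rewrite big_seq [leRHS]big_seq; apply: ler_sum => p /(allP sqP) /andP[p1 p2].
by rewrite mulr1; apply: gst; exact: tent_orbit_itv.
Qed.


(** Equivalently 2 <= exp (7/10), by exp (7/10) >= (1 + 7/640)^64. *)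
Lemma ln2_le : ln 2 <= 7 / 10 :> R.
Proof.
have e : (2 : R) <= expR (7 / 10).
  have -> : (7 / 10 : R) = 64%:R * (7 / 640) by field.
  rewrite expRM_natl.
  have h : (1 + 7 / 640 : R) <= expR (7 / 640) by exact: expR_ge1Dx.
  have : (1 + 7 / 640 : R) ^+ 64 <= expR (7 / 640) ^+ 64.
    by rewrite lerXn2r ?nnegrE ?expR_ge0//; lra.
  by apply: le_trans; lra.
by rewrite -[leRHS]expRK ler_ln ?posrE ?expR_gt0.
Qed.

(** Take the least k with N 2^-k below 149/100; since 149/100 < 2, the k + 1
    stencils of level k account for log2 N. *)
Lemma dyadic_scale N : (0 < N)%N -> exists k,
  149 / 200 <= (N%:R / 2 ^+ k : R) <= 149 / 100 /\ ln (N%:R : R) <= k.+1%:R * ln 2.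
Proof.
move=> N0.
have ex : exists k, (200 * N < 298 * 2 ^ k)%N.
  by exists N; have := ltn_expl N (ltnSn 1); lia.
case: (ex_minnP ex) => k kN kmin; exists k.
have lo : (149 * 2 ^ k <= 200 * N)%N.
  case: k kN kmin => [|k] kN kmin; first by lia.
  have := kmin k; rewrite expnS; case: (leqP (298 * 2 ^ k) (200 * N)); last by lia.
  by lia.
have {}kN : 200 * (N%:R : R) <= 298 * 2 ^+ k.
  by move: kN => /ltnW; rewrite -(ler_nat R) !natrM natrX.
have {}lo : 149 * 2 ^+ k <= 200 * (N%:R : R).
  by move: lo; rewrite -(ler_nat R) !natrM natrX.
have e0 : 0 < 2 ^+ k :> R by rewrite exprn_gt0.
split.
  by rewrite ler_pdivlMr// ler_pdivrMr//; apply/andP; split; lra.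
rewrite mulr_natl -lnXn// ler_ln ?posrE ?ltr0n ?exprn_gt0//.
by rewrite exprS; lra.
Qed.

Lemma L2_discrepancy_ge c g P N k : 0 <= c -> (0 < N)%N -> point_sets N P ->
  (forall u v, 0 <= u <= 1 -> 0 <= v <= 1 -> g <= stencil_energy (N%:R / 2 ^+ k) u v) ->
  ln (N%:R : R) <= k.+1%:R * ln 2 -> c ^+ 2 * (7 / 10) <= g / 16 ->
  c * Num.sqrt (ln N%:R) <= L2_discrepancy P.
Proof.
move=> c0 N0 PN gst lnN cg.
have ln0 : 0 <= ln (N%:R : R) by rewrite ln_ge0// ler1n.
have -> : c * Num.sqrt (ln N%:R) = Num.sqrt (c ^+ 2 * ln N%:R).
  by rewrite sqrtrM ?sqr_ge0// sqrtr_sqr ger0_norm.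
rewrite /L2_discrepancy ler_wsqrtr//.
apply: le_trans (integral_discrepancy_ge N0 PN gst).
apply: (@le_trans _ _ (c ^+ 2 * (k.+1%:R * (7 / 10)))).
  rewrite ler_wpM2l ?sqr_ge0// (le_trans lnN)// ler_wpM2l//; exact: ln2_le.
by rewrite mulrCA ler_wpM2l.
Qed.


End LowerBound.

(** * The two constants *)

Section Constants.
Variable R : realType.

Lemma limn_esup_ge (u : nat -> \bar R) (l : \bar R) :
  (forall n, exists2 k, (n <= k)%N & (l <= u k)%E) -> (l <= limn_esup u)%E.
Proof.
move=> H; rewrite /limn_esup /limf_esup; apply: le_ereal_inf_tmp => _ [V [n _ nV] <-].
have [k nk lk] := H n; apply: le_trans lk _.
by apply: ereal_sup_ubound; exists k => //; exact: nV.
Qed.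

Lemma normalized_min_discrepancy_ge (c : R) N : (2 <= N)%N ->
  (forall P, point_sets N P -> c * Num.sqrt (ln N%:R) <= L2_discrepancy P) ->
  (c%:E <= normalized_min_discrepancy R N)%E.
Proof.
move=> N2 H; apply: le_ereal_inf_tmp => _ [P PN <-]; rewrite lee_fin.
by rewrite ler_pdivlMr ?H// sqrtr_gt0 ln_gt0// ltr1n.
Qed.

End Constants.

Unset Implicit Arguments.

Theorem theorem1 (R : realType) :
  exists c b : R,
    [/\ 515599%:R / 10 ^+ 7 <= c < 515600%:R / 10 ^+ 7,
        610739%:R / 10 ^+ 7 <= b < 610740%:R / 10 ^+ 7,
        (c%:E <= c2bar R)%E,
        (forall (N : nat) (P : {fset R * R}), (1 <= N)%N -> point_sets N P ->
           c * Num.sqrt (ln N%:R) <= L2_discrepancy P)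
      & (b%:E <= b2bar R)%E].
Proof.
pose c : R := 515599%:R / 10 ^+ 7; pose b : R := 610739%:R / 10 ^+ 7.
have cP N P : (1 <= N)%N -> point_sets N P ->
    c * Num.sqrt (ln N%:R) <= L2_discrepancy P.
  move=> N1 PN; have [k [sk lnN]] := dyadic_scale R N1.
  apply: (@L2_discrepancy_ge R c (298 / 10000) P N k) => //.
  - by rewrite /c; lra.
  - by move=> u v hu hv; exact: stencil_energy_ge.
  - by rewrite /c; lra.
have bP m P : (0 < m)%N -> point_sets (2 ^ m) P ->
    b * Num.sqrt (ln (2 ^ m)%:R) <= L2_discrepancy P.
  move=> m0 PN; apply: (@L2_discrepancy_ge R b (418 / 10000) P (2 ^ m) m) => //.
  - by rewrite /b; lra.
  - by rewrite expn_gt0.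
  - move=> u v hu hv; rewrite natrX divff ?expf_neq0 ?pnatr_eq0//.
    exact: stencil_energy1_ge.
  - rewrite natrX lnXn// -[leLHS]mulr_natl ler_wpM2r ?ler_nat//.
    by rewrite ln_ge0// ler1n.
  - by rewrite /b; lra.
exists c, b; split => //.
- by rewrite lexx /c; lra.
- by rewrite lexx /b; lra.
- apply: le_ereal_inf_tmp => _ [N N2 <-]; apply: normalized_min_discrepancy_ge => // P.
  by apply: cP; exact: ltnW.
- apply: limn_esup_ge => n; exists (2 ^ n.+1)%N.
    by rewrite ltnW// (leq_trans (ltnSn _))// ltnW// ltn_expl.
  apply: normalized_min_discrepancy_ge => [|P]; last exact: bP.
  by rewrite expnS leq_pmulr// expn_gt0.
Qed.
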